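(* There exist universal constants $c,c_\epsilon>0$ and $d_0\in\mathbb{N}$ such that for every integer $d\ge d_0$, all $R,\beta>0$, and every $0<\epsilon\le c_\epsilon\beta R^2$, one has $$N_{\epsilon,\mathrm{det-ad}}^{\mathrm{val}}(d,R,\beta)\ge c\,d\,\min\left\{\sqrt{\frac{\beta R^2}{\epsilon}},\ \left(\frac{d}{\log(ed)}\right)^{1/3}\right\}.$$
   Context: Here $\log$ is the natural logarithm, $\mathbb N$ is the set of positive integers, $\mathbb N_0=\mathbb N\cup\{0\}$, $\|\cdot\|_2$ is the Euclidean norm on $\mathbb{R}^d$, $B_2^d(r)=\{x\in\mathbb{R}^d:\|x\|_2\le r\}$, and $X:=B_2^d(R)$. ''Universal'' means independent of $d,R,\beta,\epsilon$. Objective class: $\mathcal F_\beta(d,R)$ is the set of all functions $f:\mathbb{R}^d\to\mathbb{R}$ such that (i) $f$ is convex and continuously differentiable; (ii) $\nabla f$ is globally $\beta$-Lipschitz in Euclidean norm; (iii) $f$ has a unique global minimizer $x_f^\star\in B_2^d(R/2)$. Write $f^\star=\min_x f(x)$. Algorithms: a deterministic adaptive algorithm with budget $T$ (a $T$-call algorithm) consists of Borel maps $Q_t:(X\times\mathbb{R})^{t-1}\to X$, $t=1,\dots,T$, and a Borel terminal map $Q_{\mathrm{out}}:(X\times\mathbb{R})^T\to X$; these may depend on the public parameters $(d,R,\beta,\epsilon)$. Run on a fixed objective $f$, it recursively produces the queries $x_t=Q_t((x_1,f(x_1)),\dots,(x_{t-1},f(x_{t-1})))$ and the output $\widehat x=\widehat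 x_f=Q_{\mathrm{out}}((x_1,f(x_1)),\dots,(x_T,f(x_T)))$. Complexity: for $\epsilon>0$, $N_{\epsilon,\mathrm{det-ad}}^{\mathrm{val}}(d,R,\beta)$ is the infimum (with $\inf\varnothing=+\infty$) of all $T\in\mathbb{N}_0$ for which there exists a deterministic adaptive $T$-call algorithm such that $\sup_{f\in\mathcal F_\beta(d,R)}[f(\widehat x_f)-f^\star]\le\epsilon$. *)

(* Defs.v *)
From HB Require Import structures.
From mathcomp Require Import all_boot all_order all_algebra.
From mathcomp Require Import all_classical all_reals all_analysis.

Set Implicit Arguments.
Unset Strict Implicit.
Unset Printing Implicit Defensive.

Import Order.TTheory GRing.Theory Num.Theory.
Import numFieldNormedType.Exports.

Local Open Scope classical_set_scope.
Local Open Scope ring_scope.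

(* The library norm on row vectors is the sup norm, hence an explicit
   Euclidean norm; both norms induce the same topology, so [differentiable],
   [continuous] and [open] are the usual notions. *)
Definition l2norm (R : realType) (d : nat) (x : 'rV[R]_d) : R :=
  Num.sqrt (\sum_(i < d) x ord0 i ^+ 2).

Definition l2ball (R : realType) (d : nat) (r : R) : set 'rV[R]_d :=
  [set x | l2norm x <= r].

Definition gradient (R : realType) (d : nat) (f : 'rV[R]_d -> R)
    (x : 'rV[R]_d) : 'rV[R]_d :=
  \row_(i < d) 'D_(delta_mx ord0 i) f x.

Definition continuously_differentiable (R : realType) (d : nat)
    (f : 'rV[R]_d -> R) : Prop :=
  (forall x, differentiable f x) /\ continuous (gradient f).

Definition global_minimizer (R : realType) (d : nat) (f : 'rV[R]_d -> R)
    (x : 'rV[R]_d) : Prop :=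
  forall y, f x <= f y.

Definition min_value (R : realType) (d : nat) (f : 'rV[R]_d -> R) : R :=
  inf (range f).

Definition objective_class (R : realType) (d : nat) (r beta : R) :
    set ('rV[R]_d -> R) :=
  [set f | [/\ convex_function setT f /\ continuously_differentiable f,
               forall x y, l2norm (gradient f x - gradient f y)
                           <= beta * l2norm (x - y)
             & exists2 x, x \in l2ball (r / 2) &
                 unique (global_minimizer f) x]].

Definition borel_rV (R : realType) (d : nat) :=
  g_sigma_algebraType (@open 'rV[R]_d).

(* Tuples of observations carry the product sigma-algebra, which is the Borel
   one since all the factors are second countable. *)
Definition observation (R : realType) (d : nat) :=
  (borel_rV R d * measurableTypeR R)%type.

Definition histories (R : realType) (d : nat) (r : R) (t : nat) :
    set (t.-tuple (observation R d)) :=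
  [set h | forall i, (tnth h i).1 \in l2ball r].
Arguments histories {R d} r {t}.

(* Borel maps from (X x R)^t to X, with X the ball of radius r, represented as
   maps on the ambient space; values outside [histories] are irrelevant.
   [measurable_fun D] is only meaningful for measurable D, see
   [measurable_histories]. *)
Definition borel_history_map (R : realType) (d : nat) (r : R) (t : nat)
    (Q : t.-tuple (observation R d) -> borel_rV R d) : Prop :=
  measurable_fun (histories r) Q /\
  (forall h, h \in histories r -> Q h \in l2ball r).

(* [query t] is the map choosing the query of index t+1 from the t previous
   observations; only those with t < T are constrained, and used. *)
Record algorithm (R : realType) (d : nat) (r : R) (T : nat) := Algorithm {
  query : forall t : nat, t.-tuple (observation R d) -> borel_rV R d;
  terminal : T.-tuple (observation R d) -> borel_rV R d;
  query_borel : forall t, (t < T)%N -> borel_history_map r (@query t);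
  terminal_borel : borel_history_map r terminal }.

Fixpoint transcript (R : realType) (d : nat) (r : R) (T : nat)
    (A : algorithm d r T) (f : 'rV[R]_d -> R) (t : nat) :
    t.-tuple (observation R d) :=
  if t isn't t'.+1 then [tuple] else
  let h := transcript A f t' in
  let x := query A h in
  [tuple of rcons h (x, f x)].

Definition output (R : realType) (d : nat) (r : R) (T : nat)
    (A : algorithm d r T) (f : 'rV[R]_d -> R) : 'rV[R]_d :=
  terminal A (transcript A f T).

Definition worst_case_error (R : realType) (d : nat) (r beta : R) (T : nat)
    (A : algorithm d r T) : \bar R :=
  ereal_sup [set (f (output A f) - min_value f)%:E
            | f in objective_class r beta].

Definition Nval_det_ad (R : realType) (d : nat) (r beta eps : R) : \bar R :=
  ereal_inf [set T%:R%:E | T in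
    [set T : nat | exists A : algorithm d r T,
                     (worst_case_error beta A <= eps%:E)%E]].

Lemma continuous_l2norm (R : realType) (d : nat) : continuous (@l2norm R d).
Proof.
have cS : continuous (fun x : 'rV[R]_d => \sum_(i < d) x ord0 i ^+ 2).
  apply: continuous_big => [|i _ x]; first exact: add_continuous.
  have ci := @coord_continuous R 1 d ord0 i x.
  by under eq_fun do rewrite expr2; exact: (cvgM ci ci).
by move=> x; exact: (continuous_comp (cS x) (@sqrt_continuous R _)).
Qed.

Lemma measurable_l2ball (R : realType) (d : nat) (r : R) :
  measurable (l2ball r : set (borel_rV R d)).
Proof.
rewrite -[l2ball r]setCK; apply: measurableC; apply: sub_sigma_algebra.
rewrite /= openC.
exact: (proj1 (continuous_closedP _) (@continuous_l2norm R d) _ (@closed_le R r)).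
Qed.

Lemma measurable_histories (R : realType) (d : nat) (r : R) (t : nat) :
  measurable (histories r : set (t.-tuple (observation R d))).
Proof.
have -> : (histories r : set (t.-tuple (observation R d))) =
    \bigcap_(i in [set: 'I_t]) ((fun h => (tnth h i).1) @^-1` l2ball r).
  apply/seteqP; split=> h /= H i => [_|]; first by move: (H i); rewrite inE.
  by rewrite inE; exact: H.
apply: fin_bigcap_measurable => // i _; rewrite -[X in measurable X]setTI.
have mf : measurable_fun [set: t.-tuple (observation R d)]
    (fun h => (tnth h i).1 : borel_rV R d).
  by apply: (measurableT_comp measurable_fst); exact: measurable_tnth.
by apply: mf => //; exact: measurable_l2ball.
Qed.

(* Main.v *)
(* The hard objectives are Nesterov's quadratic chain, applied to the coordinates
   [y_i = <v_i, x>] of [x] in a hidden orthonormal frame, with each square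
   [(y_i - y_{i+1})^2] replaced by the square of a soft threshold, and with a
   small multiple of [|x|^2] added to make the minimizer unique.  Thanks to the
   dead zone of the soft threshold, at a point orthogonal to [v_j] and nearly
   orthogonal to [v_{j+1}, v_{j+2}, ...] the value depends only on the [v_i] with
   [i < j].  Since a value is one number and not a gradient, the adversary can
   keep answering with the first [j] vectors for about [d / 4] queries: [v_j] is
   chosen only afterwards, orthogonal to those queries and nearly orthogonal to
   all the earlier ones.  Hence [m] stages, i.e. about [m * d / 4] queries, tell
   nothing about the last [m] of the [2 * m] links of the chain, and the
   suboptimality is of order [beta * r^2 / m^2].  Near orthogonality to [N]
   points, with tolerance of order [r * sqrt (ln N / d)], is achieved by a signed
   sum of about [d / 4] orthonormal vectors; it has to be below the width
   [r / m^(3/2)] of the dead zone, whence [m^3 <= c * d / ln d]. *)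

From HB Require Import structures.
Require Import Defs.
From mathcomp Require Import all_boot all_order all_algebra.
From mathcomp Require Import all_classical all_reals all_analysis.
From mathcomp Require Import ring lra zify.

Set Implicit Arguments.
Unset Strict Implicit.
Unset Printing Implicit Defensive.

Import Order.TTheory GRing.Theory Num.Theory.
Import numFieldNormedType.Exports.

Local Open Scope classical_set_scope.
Local Open Scope ring_scope.

(** * Euclidean inner product, comparison with the sup norm, Bessel's inequality *)

Section DotProduct.
Context {R : realType} {d : nat}.
Implicit Types (x y z : 'rV[R]_d) (c : R).

Definition dot x y : R := \sum_(i < d) x ord0 i * y ord0 i.

Lemma dotC x y : dot x y = dot y x.
Proof. by apply: eq_bigr => i _; rewrite mulrC. Qed.

Lemma dotDl x y z : dot (x + y) z = dot x z + dot y z.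
Proof. by rewrite -big_split; apply: eq_bigr => i _; rewrite mxE mulrDl. Qed.

Lemma dotZl c x y : dot (c *: x) y = c * dot x y.
Proof. by rewrite mulr_sumr; apply: eq_bigr => i _; rewrite mxE mulrA. Qed.

Lemma dotDr x y z : dot x (y + z) = dot x y + dot x z.
Proof. by rewrite dotC dotDl !(dotC _ x). Qed.

Lemma dotZr c x y : dot x (c *: y) = c * dot x y.
Proof. by rewrite dotC dotZl dotC. Qed.

Lemma dotNl x y : dot (- x) y = - dot x y.
Proof. by rewrite -scaleN1r dotZl mulN1r. Qed.

Lemma dotNr x y : dot x (- y) = - dot x y.
Proof. by rewrite dotC dotNl dotC. Qed.

Lemma dotBl x y z : dot (x - y) z = dot x z - dot y z.
Proof. by rewrite dotDl dotNl. Qed.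

Lemma dotBr x y z : dot x (y - z) = dot x y - dot x z.
Proof. by rewrite dotDr dotNr. Qed.

Lemma dot0l x : dot 0 x = 0.
Proof. by rewrite -(scale0r x) dotZl mul0r. Qed.

Lemma dot0r x : dot x 0 = 0.
Proof. by rewrite dotC dot0l. Qed.

Lemma dot_suml (I : Type) (s : seq I) (P : pred I) (F : I -> 'rV[R]_d) y :
  dot (\sum_(i <- s | P i) F i) y = \sum_(i <- s | P i) dot (F i) y.
Proof.
by apply: (big_morph (dot^~ y)) => [u v|]; rewrite ?dotDl ?dot0l.
Qed.

Lemma dot_sumr (I : Type) (s : seq I) (P : pred I) (F : I -> 'rV[R]_d) y :
  dot y (\sum_(i <- s | P i) F i) = \sum_(i <- s | P i) dot y (F i).
Proof. by rewrite dotC dot_suml; apply: eq_bigr => i _; rewrite dotC. Qed.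

Lemma dot_ge0 x : 0 <= dot x x.
Proof. by apply: sumr_ge0 => i _; rewrite -expr2 sqr_ge0. Qed.

Lemma dot_eq0 x : dot x x = 0 -> x = 0.
Proof.
move=> /eqP; rewrite psumr_eq0 => [/allP x0|i _]; last by rewrite -expr2 sqr_ge0.
apply/rowP => i; rewrite mxE.
by have := x0 i (mem_index_enum i); rewrite mulf_eq0 orbb => /eqP.
Qed.

Lemma dot_delta x i : dot x (delta_mx ord0 i) = x ord0 i.
Proof.
rewrite /dot (bigD1 i) //= mxE !eqxx mulr1 big1 ?addr0 // => j /negbTE ji.
by rewrite mxE ji andbF mulr0.
Qed.

Lemma l2normE x : l2norm x = Num.sqrt (dot x x).
Proof. by congr Num.sqrt; apply: eq_bigr => i _; rewrite expr2. Qed.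

Lemma l2norm_sqr x : l2norm x ^+ 2 = dot x x.
Proof. by rewrite l2normE sqr_sqrtr // dot_ge0. Qed.

Lemma l2norm_ge0 x : 0 <= l2norm x.
Proof. by rewrite l2normE sqrtr_ge0. Qed.

Lemma l2norm_le x c : 0 <= c -> (l2norm x <= c) = (dot x x <= c ^+ 2).
Proof.
by move=> c0; rewrite -l2norm_sqr ler_pXn2r // ?nnegrE ?l2norm_ge0.
Qed.

Lemma sqr_coord_le_dot x i : x ord0 i ^+ 2 <= dot x x.
Proof.
rewrite /dot (bigD1 i) //= expr2 lerDl.
by apply: sumr_ge0 => j _; rewrite -expr2 sqr_ge0.
Qed.

Lemma norm_le_l2norm x : `|x| <= l2norm x.
Proof.
rewrite [`|x|]mx_normrE; apply: bigmax_le => [|[i j] _]; first exact: l2norm_ge0.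
rewrite ord1 l2normE -sqrtr_sqr ler_wsqrtr // sqr_coord_le_dot //.
Qed.

Lemma dot_le_norm x : dot x x <= d%:R * `|x| ^+ 2.
Proof.
apply: le_trans (_ : \sum_(i < d) `|x| ^+ 2 <= _); last first.
  by rewrite sumr_const card_ord mulr_natl.
apply: ler_sum => i _; rewrite -expr2 -real_normK ?num_real //.
rewrite ler_pXn2r ?nnegrE //.
by rewrite [`|x|]mx_normrE (le_bigmax _ (fun p => `|x p.1 p.2|) (ord0, i)).
Qed.

Lemma dot_continuous x : continuous (dot x).
Proof.
apply: continuous_big => [|i _ y]; first exact: add_continuous.
exact: (cvgM (cvg_cst (x ord0 i)) (@coord_continuous R 1 d ord0 i y)).
Qed.

Lemma bessel (n : nat) (v : nat -> 'rV[R]_d) x :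
  (forall i j, (i < n)%N -> (j < n)%N -> dot (v i) (v j) = (i == j)%:R) ->
  \sum_(i < n) dot (v i) x ^+ 2 <= dot x x.
Proof.
move=> vo; pose p := \sum_(i < n) dot (v i) x *: v i.
have vp i : (i < n)%N -> dot (v i) p = dot (v i) x.
  move=> ltin; rewrite dot_sumr (bigD1 (Ordinal ltin)) //= dotZr vo // eqxx mulr1.
  rewrite big1 ?addr0 // => j; rewrite -val_eqE /= eq_sym => /negbTE ij.
  by rewrite dotZr vo // ij mulr0.
have pp : dot p p = \sum_(i < n) dot (v i) x ^+ 2.
  rewrite [in LHS]/p dot_suml; apply: eq_bigr => i _.
  by rewrite dotZl vp // expr2.
have px : dot p x = \sum_(i < n) dot (v i) x ^+ 2.
  by rewrite dot_suml; apply: eq_bigr => i _; rewrite dotZl expr2.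
have := dot_ge0 (x - p); rewrite dotBl !dotBr (dotC x p) pp px; lra.
Qed.

End DotProduct.

(** * A criterion for membership in the objective class *)

Section ObjectiveClass.
Context {R : realType} {d : nat}.
Implicit Types (f : 'rV[R]_d -> R) (x y g : 'rV[R]_d) (G : 'rV[R]_d -> 'rV[R]_d).

Lemma dot_linear x : linear (dot x : 'rV[R]_d -> R^o).
Proof. by move=> c y z; rewrite dotDr dotZr. Qed.

HB.instance Definition _ x :=
  GRing.isLinear.Build R 'rV[R]_d R^o *:%R (dot x) (dot_linear x).

(** Since [dot h h] is at most [d] times the squared sup norm, the error is [o(h)], and uniqueness
    of the differential identifies it with [dot g]. *)
Lemma differentiable_of_quadratic_error f x g (C : R) :
  (forall h, `|f (x + h) - f x - dot g h| <= C * dot h h) ->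
  differentiable f x /\ forall v, 'D_v f x = dot g v.
Proof.
move=> fg.
have exp : (f : 'rV[R]_d -> R^o) \o shift x =
    cst (f x) + (dot g : 'rV[R]_d -> R^o) +o_ (0 : 'rV[R]_d) id.
  (* The added ones keep [K] positive whatever [C] is, and also when [d = 0]. *)
  apply/eqaddoP => e e0; set K : R := (`|C| + 1) * (d%:R + 1).
  have K0 : 0 < K by rewrite mulr_gt0 // ltr_wpDl.
  have e'0 : 0 < e / K by rewrite divr_gt0.
  have hK : \forall h \near (0 : 'rV[R]_d), `|h| < e / K by exact: nbhs0_lt.
  apply: filterS hK => h hK; rewrite (_ : _ h = f (x + h) - f x - dot g h); last first.
    by rewrite !fctE /= (addrC x) opprD addrA.
  apply: le_trans (fg h) _.
  apply: le_trans (_ : K * `|h| ^+ 2 <= _).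
    rewrite -mulrA; apply: le_trans (_ : (`|C| + 1) * dot h h <= _).
      rewrite ler_wpM2r ?dot_ge0 //.
      by apply: le_trans (ler_norm C) _; rewrite lerDl.
    rewrite ler_wpM2l ?addr_ge0 //; apply: le_trans (dot_le_norm h) _.
    by rewrite ler_wpM2r ?sqr_ge0 // lerDl.
  rewrite expr2 mulrA ler_wpM2r // mulrC -ler_pdivlMr // ltW //.
have dgc : continuous (dot g : 'rV[R]_d -> R^o) by exact: dot_continuous.
have dE := diff_unique dgc exp.
have df : differentiable f x.
  by apply/diff_locallyP; rewrite dE; split.
by split=> // v; rewrite deriveE // dE.
Qed.

Lemma l2norm_lipschitz_continuous G (L : R) : 0 <= L ->
  (forall x y, l2norm (G x - G y) <= L * l2norm (x - y)) -> continuous G.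
Proof.
move=> L0 GL x.
apply: ((@cvgrPdist_lt R 'rV[R]_d 'rV[R]_d (nbhs x) (nbhs_filter x) G (G x)).2).
move=> e e0.
have e'0 : 0 < e / (L + 1) by rewrite divr_gt0 // ltr_wpDl.
have cN : {for x, continuous (fun y => l2norm (x - y))}.
  apply: (@continuous_comp _ _ _ (fun y => x - y) (@l2norm R d)).
    exact: (@cvgB R 'rV[R]_d _ (nbhs x) _ (cst x) id x x (cvg_cst _) cvg_id).
  exact: continuous_l2norm.
have : \forall y \near x, l2norm (x - y) < e / (L + 1).
  apply: (cN (fun z => z < e / (L + 1))).
  rewrite subrr (_ : l2norm 0 = 0) //; last by rewrite l2normE dot0l sqrtr0.
  exact: lt_nbhsl.
apply: filterS => y yx; apply: le_lt_trans (norm_le_l2norm _) _.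
apply: le_lt_trans (GL _ _) _.
apply: le_lt_trans (_ : (L + 1) * l2norm (x - y) < _).
  by rewrite ler_wpM2r ?l2norm_ge0 // lerDl.
by rewrite mulrC -ltr_pdivlMr // ltr_wpDl.
Qed.

(** The two-sided quadratic bound makes [G] the gradient, and its lower half is strong convexity,
    whence convexity and uniqueness of the minimizer. Existence comes from compactness, localization
    from the last hypothesis. *)
Lemma objective_classI f G (mu C beta r : R) : 0 < mu -> 0 <= beta -> 0 < r ->
  (forall x h, mu * dot h h <= f (x + h) - f x - dot (G x) h <= C * dot h h) ->
  (forall x y, l2norm (G x - G y) <= beta * l2norm (x - y)) ->
  (forall x, (r / 2) ^+ 2 < dot x x -> f 0 < f x) ->
  objective_class r beta f.
Proof.
move=> mu0 beta0 r0 fG GL coer.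
have r20 : 0 < r / 2 by rewrite divr_gt0.
have fd x : differentiable f x /\ forall v, 'D_v f x = dot (G x) v.
  apply: (@differentiable_of_quadratic_error _ _ _ C) => h.
  have /andP[lo up] := fG x h; rewrite ger0_norm //.
  by apply: le_trans lo; rewrite mulr_ge0 ?dot_ge0 // ltW.
have gE : gradient f = G.
  apply/funext => x; apply/rowP => i; rewrite mxE (fd x).2 dot_delta //.
have fc : continuous f.
  by move=> x; apply: differentiable_continuous; exact: (fd x).1.
have lower x y : f x + dot (G x) (y - x) + mu * dot (y - x) (y - x) <= f y.
  have /andP[lo _] := fG x (y - x); move: lo; rewrite subrKC; lra.
have [x0 x0r x0m] : exists2 x0, dot x0 x0 <= (r / 2) ^+ 2 & forall y, f x0 <= f y.
  (* The cube of half-side [r / 2] contains the ball of that radius. Outside the ball [f] exceeds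
     [f 0], so a minimizer over the cube is global and lies in the ball. *)
  pose A := [set v : 'rV[R]_d | forall i, `[- (r / 2), r / 2]%classic (v ord0 i)].
  have A0 : A 0 by move=> i; rewrite mxE /= in_itv /=; lra.
  have cA : compact A.
    apply: (@rV_compact R d (fun=> `[- (r / 2), r / 2]%classic)) => i.
    exact: segment_compact.
  have [x0 _ x0m] : exists2 c, c \in A & forall t, t \in A -> f c <= f t.
    apply: compact_EVT_min => //; first by exists 0.
    exact: continuous_subspaceT.
  have m y : f x0 <= f y.
    have [yr|yr] := lerP (dot y y) ((r / 2) ^+ 2); last first.
      by apply: le_trans (ltW (coer _ yr)); apply: x0m; rewrite inE.
    apply: x0m; rewrite inE => i /=; rewrite in_itv /=.
    have := le_trans (sqr_coord_le_dot y i) yr.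
    by rewrite -ler_norml -real_normK ?num_real // ler_pXn2r // nnegrE // ltW.
  exists x0 => //; rewrite leNgt; apply/negP => /coer.
  by rewrite ltNge m.
split.
- split; last first.
    split=> [x|]; first exact: (fd x).1.
    by rewrite gE; exact: l2norm_lipschitz_continuous GL.
  move=> t x y _ _; rewrite !convRE /conv /=.
  have /andP[t0 t1] : 0 <= t%:num <= 1 by rewrite ge0 le1.
  move: (t%:num) t0 t1 => p p0 p1; rewrite /unstable.onem.
  set z := p *: x + (1 - p) *: y.
  (* Weighting these two bounds by [p] and [1 - p] cancels the gradient terms. *)
  have lx := lower z x; have ly := lower z y.
  have xz : x - z = (1 - p) *: (x - y).
    by rewrite /z; apply/rowP => i; rewrite !mxE; ring.
  have yz : y - z = (- p) *: (x - y).
    by rewrite /z; apply/rowP => i; rewrite !mxE; ring.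
  rewrite xz !dotZl !dotZr in lx; rewrite yz !dotZl !dotZr in ly.
  have := dot_ge0 (x - y).
  move: (dot (G z) (x - y)) (dot (x - y) (x - y)) lx ly => u v lx ly v0.
  have {}lx : f z + (1 - p) * u <= f x.
    by apply: le_trans lx; rewrite lerDl !mulr_ge0 // ?subr_ge0 // ltW.
  have {}ly : f z - p * u <= f y.
    by apply: le_trans ly; rewrite !mulNr mulrN opprK lerDl !mulr_ge0 // ltW.
  have := lerD (ler_wpM2l p0 lx) (ler_wpM2l (_ : 0 <= 1 - p) ly).
  rewrite subr_ge0 => /(_ p1); apply: le_trans.
  by rewrite le_eqVlt; apply/orP; left; apply/eqP; ring.
- by rewrite gE.
- exists x0.
    by rewrite inE /l2ball /= l2norm_le // ltW.
  split=> // y ym.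
  (* At the midpoint [z] of two minimizers the gradient terms of both lower bounds cancel, which
     leaves [2 * mu * dot h h <= 0]. *)
  pose z := 2^-1 *: (x0 + y); pose h := 2^-1 *: (y - x0).
  have hx : x0 - z = - h by apply/rowP => i; rewrite !mxE; field.
  have hy : y - z = h by apply/rowP => i; rewrite !mxE; field.
  have := lower z x0; have := lower z y; have := ym z; have := x0m z.
  rewrite hx hy dotNr dotNl dotNr => xz yz ly lx.
  have h0 : h = 0.
    apply: dot_eq0; apply/eqP; rewrite eq_le dot_ge0 andbT -(pmulr_rle0 _ mu0).
    by lra.
  apply/esym/eqP; rewrite -subr_eq0 -(scalerK (_ : 2^-1 != 0 :> R) (y - x0)).
    by rewrite -/h h0 scaler0.
  by rewrite invr_eq0 pnatr_eq0.
Qed.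

End ObjectiveClass.

(** * The soft threshold and half its square *)

Section SoftThreshold.
Context {R : realType}.
Implicit Types (delta t h a : R).

(** For [0 <= delta] this is [t] minus its projection onto [[- delta, delta]]. Half its square is
    half the squared distance to that interval, with derivative [soft delta]. *)
Definition soft delta t : R := Num.max (t - delta) 0 - Num.max (- t - delta) 0.

Variant soft_spec delta t : R -> Prop :=
| SoftLeft of t <= - delta : soft_spec delta t (t + delta)
| SoftDead of - delta <= t & t <= delta : soft_spec delta t 0
| SoftRight of delta <= t : soft_spec delta t (t - delta).

Lemma softP delta t : 0 <= delta -> soft_spec delta t (soft delta t).
Proof.
move=> d0; rewrite /soft.
have [tr|tr] := lerP delta t.
  have -> : Num.max (t - delta) 0 = t - delta by apply: max_l; lra.
  have -> : Num.max (- t - delta) 0 = 0 by apply: max_r; lra.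
  by rewrite subr0; exact: SoftRight.
have -> : Num.max (t - delta) 0 = 0 by apply: max_r; lra.
have [tl|tl] := lerP t (- delta).
  have -> : Num.max (- t - delta) 0 = - t - delta by apply: max_l; lra.
  have -> : 0 - (- t - delta) = t + delta by ring.
  exact: SoftLeft.
have -> : Num.max (- t - delta) 0 = 0 by apply: max_r; lra.
by rewrite subrr; apply: SoftDead; exact: ltW.
Qed.

Lemma soft_homo delta t u : 0 <= delta -> t <= u ->
  0 <= soft delta u - soft delta t <= u - t.
Proof.
by move=> d0 tu; case: (softP t d0) => *; case: (softP u d0) => *; lra.
Qed.

Lemma soft_lipschitz delta t u : 0 <= delta ->
  (soft delta t - soft delta u) ^+ 2 <= (t - u) ^+ 2.
Proof.
move=> d0; wlog tu : t u / t <= u => [th|].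
  have [/th//|/ltW/th] := lerP t u.
  by rewrite -(opprB t u) -(opprB (soft delta t)) !sqrrN.
by have /andP[lo up] := soft_homo d0 tu; nra.
Qed.

Lemma soft_dead delta t : 0 <= delta -> `|t| <= delta -> soft delta t = 0.
Proof. by rewrite ler_norml => d0 /andP[? ?]; case: (softP t d0) => *; lra. Qed.

Lemma soft_sqr_taylor delta t h : 0 <= delta ->
  0 <= soft delta (t + h) ^+ 2 / 2 - soft delta t ^+ 2 / 2 - soft delta t * h
    <= h ^+ 2.
Proof.
move=> d0; case: (softP t d0) => *; case: (softP (t + h) d0) => *;
by apply/andP; split; nra.
Qed.

Lemma soft_sqr_le delta t : 0 <= delta -> soft delta t ^+ 2 <= t ^+ 2.
Proof. by move=> d0; case: (softP t d0) => *; nra. Qed.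

(** The right-hand side is minimal at [t = delta + a], where it equals the left-hand side. *)
Lemma soft_sqr_ge delta a t : 0 <= delta -> 0 <= a ->
  - (a ^+ 2 / 2 + a * delta) <= soft delta t ^+ 2 / 2 - a * t.
Proof.
move=> d0 a0; have := sqr_ge0 (t - delta - a).
by case: (softP t d0) => [tl|tl tr|tr]; have := mulr_ge0 a0 d0; nra.
Qed.

End SoftThreshold.

(** * The chain: curvature, smoothness and lower bounds *)

Section Chain.
Context {R : realType} {d : nat}.
Implicit Types (v : nat -> 'rV[R]_d) (x y h : 'rV[R]_d).

Definition orthonormal n v :=
  forall i j, (i < n)%N -> (j < n)%N -> dot (v i) (v j) = (i == j)%:R.

(** The frame is used with [v n = 0]: the last link then ties the last coordinate to zero, while the
    linear term pulls the first one upwards. Vectors not chosen yet are also represented by zero. *)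
Definition chain n a delta mu v x : R :=
  - a * dot (v 0%N) x + \sum_(i < n) soft delta (dot (v i - v i.+1) x) ^+ 2 / 2
  + mu * dot x x.

Definition chain_grad n a delta mu v x : 'rV[R]_d :=
  - a *: v 0%N + \sum_(i < n) soft delta (dot (v i - v i.+1) x) *: (v i - v i.+1)
  + (2 * mu) *: x.

(** Each square is at most [2 * p ^+ 2 + 2 * q ^+ 2], and Bessel's inequality applies to both
    families; the shifted one stays within the frame because [v n = 0]. *)
Lemma sum_sqr_link_le n v x : orthonormal n v -> v n = 0 ->
  \sum_(i < n) dot (v i - v i.+1) x ^+ 2 <= 4 * dot x x.
Proof.
move=> vo vn; have B := bessel x vo.
have S : \sum_(i < n) dot (v i.+1) x ^+ 2 <= \sum_(i < n) dot (v i) x ^+ 2.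
  have : \sum_(i < n.+1) dot (v i) x ^+ 2 = \sum_(i < n) dot (v i) x ^+ 2.
    by rewrite big_ord_recr /= vn dot0l expr0n addr0.
  rewrite big_ord_recl /= => <-.
  by rewrite lerDr sqr_ge0.
apply: le_trans
  (_ : \sum_(i < n) (2 * dot (v i) x ^+ 2 + 2 * dot (v i.+1) x ^+ 2) <= _).
  apply: ler_sum => i _; rewrite dotBl.
  have := sqr_ge0 (dot (v i) x + dot (v i.+1) x); nra.
rewrite big_split -!mulr_sumr /=; lra.
Qed.

(** The linear term and the multiple of [dot x x] expand exactly, so only the links leave an error
    to be estimated, each by [soft_sqr_taylor]. *)
Lemma chain_taylor n a delta mu v x h :
  0 <= delta -> orthonormal n v -> v n = 0 ->
  mu * dot h h <= chain n a delta mu v (x + h) - chain n a delta mu v x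
                  - dot (chain_grad n a delta mu v x) h
               <= (4 + mu) * dot h h.
Proof.
move=> d0 vo vn.
set b := fun i => v i - v i.+1.
have -> : chain n a delta mu v (x + h) - chain n a delta mu v x
          - dot (chain_grad n a delta mu v x) h =
  \sum_(i < n) (soft delta (dot (b i) x + dot (b i) h) ^+ 2 / 2
     - soft delta (dot (b i) x) ^+ 2 / 2 - soft delta (dot (b i) x) * dot (b i) h)
  + mu * dot h h.
  have E : dot (\sum_(i < n) soft delta (dot (b i) x) *: b i) h =
      \sum_(i < n) soft delta (dot (b i) x) * dot (b i) h.
    by rewrite dot_suml; apply: eq_bigr => i _; rewrite dotZl.
  rewrite 2!big_split /= !sumrN /chain /chain_grad.
  rewrite !dotDl !dotDr E !dotZl (dotC h x).
  under [X in _ * (_ + _) + X]eq_bigr do rewrite dotDr.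
  by rewrite /b; ring.
apply/andP; split.
  rewrite lerDr sumr_ge0 // => i _.
  by have /andP[] := soft_sqr_taylor (dot (b i) x) (dot (b i) h) d0.
rewrite mulrDl lerD2r; apply: le_trans (sum_sqr_link_le h vo vn).
apply: ler_sum => i _.
by have /andP[] := soft_sqr_taylor (dot (b i) x) (dot (b i) h) d0.
Qed.

Lemma chain_grad_lipschitz n a delta mu v x y :
  0 <= delta -> 0 <= mu <= 1 -> orthonormal n v -> v n = 0 ->
  l2norm (chain_grad n a delta mu v x - chain_grad n a delta mu v y)
    <= 8 * l2norm (x - y).
Proof.
move=> d0 /andP[mu0 mu1] vo vn.
set b := fun i => v i - v i.+1.
pose g i := soft delta (dot (b i) x) - soft delta (dot (b i) y).
pose p := \sum_(i < n) g i *: b i; pose h := x - y.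
have -> : chain_grad n a delta mu v x - chain_grad n a delta mu v y =
          p + (2 * mu) *: h.
  rewrite /p; under eq_bigr do rewrite scalerBl.
  rewrite big_split /= sumrN /chain_grad -/b scalerBr.
  by apply/rowP => i; rewrite !mxE; ring.
have G : \sum_(i < n) g i ^+ 2 <= 4 * dot h h.
  apply: le_trans (sum_sqr_link_le h vo vn); apply: ler_sum => i _.
  by rewrite dotBr; exact: soft_lipschitz.
(* Young's inequality with weights 2 and 1/8: by [sum_sqr_link_le] the second sum is at most
   [dot p p / 2], which is absorbed on the left. *)
have pp : dot p p <= 16 * dot h h.
  have : dot p p <= \sum_(i < n) (2 * g i ^+ 2 + dot (b i) p ^+ 2 / 8).
    rewrite {1}/p dot_suml; apply: ler_sum => i _; rewrite dotZl.
    have := sqr_ge0 (4 * g i - dot (b i) p); nra.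
  rewrite big_split /= -mulr_sumr -mulr_suml.
  have B : \sum_(i < n) dot (b i) p ^+ 2 <= 4 * dot p p := sum_sqr_link_le p vo vn.
  lra.
rewrite l2norm_le ?mulr_ge0 ?l2norm_ge0 // exprMn l2norm_sqr -/h.
clearbody h p => {G}.
have := dot_ge0 (p - (2 * mu) *: h); rewrite dotBl !dotBr dotDl !dotDr !dotZl !dotZr.
rewrite (dotC h p) => sq; have h0 := dot_ge0 h.
have : mu * mu * dot h h <= dot h h by rewrite ler_piMl // mulr_ile1.
by lra.
Qed.

(* The links telescope: [dot (v 0) x] is the sum of the first [m] link values
   and [dot (v m) x]. *)
Lemma chain_potential_ge m n a delta v x : (m <= n)%N -> 0 <= delta -> 0 <= a ->
  - (m%:R * (a ^+ 2 / 2 + a * delta)) - a * dot (v m) x <=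
  - a * dot (v 0%N) x + \sum_(i < n) soft delta (dot (v i - v i.+1) x) ^+ 2 / 2.
Proof.
move=> mn d0 a0.
pose F i := soft delta (dot (v i - v i.+1) x) ^+ 2 / 2.
have F0 i : 0 <= F i by rewrite divr_ge0 ?sqr_ge0.
apply: le_trans (_ : - a * dot (v 0%N) x + \sum_(i < m) F i <= _); last first.
  rewrite lerD2l -!(big_mkord xpredT F) (big_cat_nat (leq0n m) mn) /= lerDl.
  exact: sumr_ge0.
have tele : \sum_(i < m) dot (v i - v i.+1) x = dot (v 0%N) x - dot (v m) x.
  elim: (m) => [|k IH]; first by rewrite big_ord0 subrr.
  by rewrite big_ord_recr /= IH dotBl addrA subrK.
have : \sum_(i < m) (F i - a * dot (v i - v i.+1) x) >=
       \sum_(i < m) - (a ^+ 2 / 2 + a * delta).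
  by apply: ler_sum => i _; exact: soft_sqr_ge.
rewrite sumr_const card_ord big_split /= sumrN -mulr_sumr tele -mulr_natl.
lra.
Qed.

(** The factor [beta / 8] turns the Lipschitz constant 8 into [beta]. The last hypothesis says that
    beyond radius [r / 2] the quadratic term outweighs the lowest value the rest can take, so the
    chain is positive there. *)
Lemma chain_objective n a delta mu v (r beta : R) :
  0 <= a -> 0 <= delta -> 0 < mu <= 1 -> orthonormal n v -> v n = 0 ->
  0 < beta -> 0 < r -> (0 < n)%N ->
  n%:R * (a ^+ 2 / 2 + a * delta) < mu * (r / 2) ^+ 2 ->
  objective_class r beta (fun x => beta / 8 * chain n a delta mu v x).
Proof.
move=> a0 d0 /andP[mu0 mu1] vo vn beta0 r0 n0 hr.
have b80 : 0 < beta / 8 by rewrite divr_gt0.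
apply: (@objective_classI _ _ _ (fun x => beta / 8 *: chain_grad n a delta mu v x)
   (beta / 8 * mu) (beta / 8 * (4 + mu))) => //.
- by rewrite mulr_gt0.
- exact: ltW.
- move=> x h; have /andP[lo up] := chain_taylor a mu x h d0 vo vn.
  by rewrite dotZl -!mulrBr -(mulrA _ mu) -(mulrA _ (4 + mu)) !ler_pM2l // lo up.
- move=> x y; rewrite -scalerBr.
  have -> : beta * l2norm (x - y) = beta / 8 * (8 * l2norm (x - y)) by field.
  rewrite l2norm_le; last by rewrite !mulr_ge0 ?l2norm_ge0 // ltW.
  rewrite dotZl dotZr mulrA -expr2 [leRHS]exprMn ler_pM2l ?exprn_gt0 //.
  rewrite -l2norm_le ?mulr_ge0 ?l2norm_ge0 //.
  by apply: chain_grad_lipschitz => //; rewrite (ltW mu0) mu1.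
- move=> x xr; rewrite ltr_pM2l //.
  have -> : chain n a delta mu v 0 = 0.
    rewrite /chain !dot0r !mulr0 !addr0 big1 ?addr0 // => i _.
    by rewrite dot0r soft_dead ?normr0 // expr0n mul0r.
  apply: lt_le_trans (_ : - (n%:R * (a ^+ 2 / 2 + a * delta)) + mu * dot x x <= _).
    rewrite addrC subr_gt0; apply: lt_trans hr _; by rewrite ltr_pM2l.
  rewrite lerD2r.
  have := @chain_potential_ge n n a delta v x (leqnn n) d0 a0.
  by rewrite vn dot0l mulr0 subr0.
Qed.

End Chain.

(** * Unit vectors nearly orthogonal to many given points *)

Section FlatDirection.
Context {R : realType} {d : nat}.
Implicit Types (u v : nat -> 'rV[R]_d) (x y w : 'rV[R]_d) (xs : seq 'rV[R]_d).

(** A matrix with more rows than columns has a nonzero left kernel. *)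
Lemma exists_unit_orthogonal xs : (size xs < d)%N ->
  exists2 w, dot w w = 1 & {in xs, forall x, dot w x = 0}.
Proof.
move=> sd; pose A : 'M[R]_(d, size xs) := \matrix_(i, j) xs`_j ord0 i.
have /rowV0Pn[w /sub_kermxP wA w0] : kermx A != 0.
  by rewrite -mxrank_eq0 mxrank_ker subn_eq0 -ltnNge (leq_ltn_trans (rank_leq_col A)).
have wo : {in xs, forall x, dot w x = 0}.
  move=> x xin; have xi : (index x xs < size xs)%N by rewrite index_mem.
  have := congr1 (fun B : 'rV_(size xs) => B ord0 (Ordinal xi)) wA.
  rewrite !mxE => <-; apply: eq_bigr => i _.
  by rewrite mxE nth_index.
have ww : 0 < dot w w.
  rewrite lt_neqAle dot_ge0 andbT eq_sym; apply: contra_neq w0; exact: dot_eq0.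
exists ((Num.sqrt (dot w w))^-1 *: w).
  by rewrite dotZl dotZr mulrA -expr2 exprVn sqr_sqrtr ?mulVf ?gt_eqF // ltW.
by move=> x xin; rewrite dotZl (wo x xin) mulr0.
Qed.

Lemma exists_orthonormal_orthogonal xs D : (size xs + D <= d)%N ->
  exists2 u, orthonormal D u &
    forall i, (i < D)%N -> {in xs, forall x, dot (u i) x = 0}.
Proof.
elim: D => [|D IH] sD; first by exists (fun=> 0).
have [|u uo ux] := IH; first by apply: leq_trans sD; rewrite leq_add2l.
have [|w ww wx] := @exists_unit_orthogonal (xs ++ mkseq u D).
  by rewrite size_cat size_mkseq -addnS.
have wu i : (i < D)%N -> dot w (u i) = 0.
  move=> iD; apply: wx; rewrite mem_cat; apply/orP; right.
  by apply/mapP; exists i; rewrite ?mem_iota.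
exists (fun i => if i == D then w else u i).
  move=> i j; rewrite !ltnS (leq_eqVlt i) (leq_eqVlt j).
  have [->|iD] := eqVneq i D; have [->|jD] := eqVneq j D => //=.
  - by move=> _ /wu.
  - by move=> iltD _; rewrite dotC wu // (negbTE iD).
  - exact: uo.
move=> i; rewrite ltnS leq_eqVlt; have [->|iD] := eqVneq i D => //=.
  by move=> _ x xin; apply: wx; rewrite mem_cat xin.
exact: ux.
Qed.

(** A weak form of [cosh b <= expR (b ^+ 2 / 2)] with an elementary proof: [|b| <= 2 * b ^+ 2] for
    large [b], and [expR z <= (1 - z)^-1] for small [b]. *)
Lemma expR_add_expRN_le (b : R) : expR b + expR (- b) <= 2 * expR (2 * b ^+ 2).
Proof.
have [bl|bs] := lerP (1 / 2) `|b|.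
  have H : `|b| <= 2 * b ^+ 2.
    by rewrite -real_normK ?num_real //; have := normr_ge0 b; nra.
  have : expR b <= expR (2 * b ^+ 2).
    by rewrite ler_expR; apply: le_trans H; exact: ler_norm.
  have : expR (- b) <= expR (2 * b ^+ 2).
    by rewrite ler_expR; apply: le_trans H; rewrite -normrN; exact: ler_norm.
  lra.
move: bs; rewrite ltr_norml => /andP[b1 b2].
have inv (z : R) : z < 1 -> expR z <= (1 - z)^-1.
  move=> z1; rewrite -[expR z]invrK -expRN lef_pV2 ?posrE ?expR_gt0 ?subr_gt0 //.
  exact: expR_ge1Dx.
have := expR_ge1Dx (2 * b ^+ 2).
have := inv b ltac:(lra); have := inv (- b) ltac:(lra).
suff : (1 - b)^-1 + (1 - - b)^-1 <= 2 * (1 + 2 * b ^+ 2) by lra.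
have -> : (1 - b)^-1 + (1 - - b)^-1 = 2 / (1 - b ^+ 2).
  by field; rewrite -?natrM; apply/and3P; split; apply/eqP; nra.
have : b ^+ 2 <= 1 / 4 by nra.
have := sqr_ge0 b; move: (b ^+ 2) => c c0 c1.
rewrite ler_pdivrMr; nra.
Qed.

(* Signs chosen one at a time by conditional expectations. *)
Lemma exists_balancing_signs xs u D (l : R) (W : 'rV[R]_d -> R) :
  (forall x, 0 <= W x) ->
  exists2 e : nat -> R, forall i, e i ^+ 2 = 1 &
    \sum_(x <- xs) W x * (expR (l * dot (\sum_(i < D) e i *: u i) x)
                          + expR (- (l * dot (\sum_(i < D) e i *: u i) x)))
    <= 2 * \sum_(x <- xs) W x * \prod_(i < D) expR (2 * (l * dot (u i) x) ^+ 2).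
Proof.
elim: D W => [|D IH] W W0.
  exists (fun=> 1) => [i|]; first by rewrite expr1n.
  rewrite mulr_sumr; apply: ler_sum => x _.
  by rewrite !big_ord0 dot0l mulr0 oppr0 expR0; lra.
(* The factor of the last vector goes into the weight, so the other signs are chosen first; [S c] is
   the potential once the last sign is [c], and one of [S 1], [S (-1)] is at most their average. *)
have [|e e1 He] := IH (fun x => W x * expR (2 * (l * dot (u D) x) ^+ 2)).
  by move=> x; rewrite mulr_ge0 ?expR_ge0.
pose s x := l * dot (\sum_(i < D) e i *: u i) x; pose t x := l * dot (u D) x.
pose S (c : R) :=
  \sum_(x <- xs) W x * (expR (s x + c * t x) + expR (- (s x + c * t x))).
have SS : S 1 + S (-1) <= 2 * (2 * \sum_(x <- xs) W x *
    \prod_(i < D.+1) expR (2 * (l * dot (u i) x) ^+ 2)).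
  apply: le_trans (_ : 2 * (\sum_(x <- xs) W x * expR (2 * t x ^+ 2) *
     (expR (s x) + expR (- s x))) <= _).
    rewrite -big_split mulr_sumr; apply: ler_sum => x _ /=.
    have -> : 2 * (W x * expR (2 * t x ^+ 2) * (expR (s x) + expR (- s x))) =
        W x * (2 * expR (2 * t x ^+ 2) * (expR (s x) + expR (- s x))) by ring.
    rewrite -mulrDr ler_wpM2l //.
    rewrite !mul1r !mulN1r !opprD opprK !expRD.
    have := expR_add_expRN_le (t x); have := expR_gt0 (s x); have := expR_gt0 (- s x).
    set A := expR (s x); set B := expR (- s x); move=> B0 A0 T.
    apply: le_trans (_ : (A + B) * (expR (t x) + expR (- t x)) <= _); first by lra.
    apply: le_trans (ler_wpM2l (_ : 0 <= A + B) T) _; first by lra.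
    by lra.
  rewrite ler_pM2l //; apply: le_trans He _.
  rewrite ler_pM2l //; apply: ler_sum => x _.
  by rewrite big_ord_recr /= -mulrA [X in W x * X]mulrC.
have [c c1 Sc] : exists2 c : R, c ^+ 2 = 1 & S c <= 2 * \sum_(x <- xs) W x *
    \prod_(i < D.+1) expR (2 * (l * dot (u i) x) ^+ 2).
  have [S1|S1] := lerP (S 1) (S (-1)).
    by exists 1; rewrite ?expr1n //; lra.
  by exists (-1); rewrite ?sqrrN ?expr1n //; lra.
exists (fun i => if i == D then c else e i) => [i|]; first by case: ifP.
apply: le_trans Sc; apply: ler_sum => x _.
have -> : \sum_(i < D.+1) (if i == D :> nat then c else e i) *: u i =
    \sum_(i < D) e i *: u i + c *: u D.
  rewrite big_ord_recr /= eqxx; congr (_ + _); apply: eq_bigr => i _.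
  by rewrite ltn_eqF.
by rewrite dotDl dotZl (mulrDr l) (mulrCA l c).
Qed.

(** The direction is a balanced signed sum of [D] orthonormal vectors, divided by its length [q],
    the square root of [D]. By Bessel's inequality each point contributes at most
    [expR (2 * l ^+ 2 * rho ^+ 2)] to the potential, independently of [D], whereas the normalization
    gains the factor [q]. *)
Lemma exists_flat_direction xs0 xs D N (rho h : R) :
  (0 < D)%N -> (size xs0 + D <= d)%N -> (size xs <= N)%N -> 0 < rho -> 0 < h ->
  {in xs, forall x, dot x x <= rho ^+ 2} ->
  8 * rho ^+ 2 * ln (2 * N%:R) <= D%:R * h ^+ 2 ->
  exists w, [/\ dot w w = 1, {in xs0, forall x, dot w x = 0} &
                {in xs, forall x, `|dot w x| <= h}].
Proof.
move=> D0 sD sN rho0 h0 xsr hL.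
have [u uo ux0] := exists_orthonormal_orthogonal sD.
have DR : 0 < D%:R :> R by rewrite ltr0n.
pose q := Num.sqrt (D%:R : R).
have q0 : 0 < q by rewrite sqrtr_gt0.
have q2 : q ^+ 2 = D%:R by rewrite sqr_sqrtr // ltW.
(* This [l] maximizes [l * h * q - 2 * l ^+ 2 * rho ^+ 2]; the maximum is
   [D%:R * h ^+ 2 / (8 * rho ^+ 2)], which the last hypothesis compares with [ln (2 * N%:R)]. *)
pose l := h * q / (4 * rho ^+ 2).
have l0 : 0 < l by rewrite divr_gt0 ?mulr_gt0 ?exprn_gt0.
have [e e1 He] := @exists_balancing_signs xs u D l (fun=> 1) (fun=> ler01).
pose s := \sum_(i < D) e i *: u i.
have su i : (i < D)%N -> dot s (u i) = e i.
  move=> iD; rewrite dot_suml (bigD1 (Ordinal iD)) //= dotZl uo // eqxx mulr1.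
  rewrite big1 ?addr0 // => j; rewrite -val_eqE /= => /negbTE ij.
  by rewrite dotZl uo // ij mulr0.
have ss : dot s s = D%:R.
  rewrite {2}/s dot_sumr (eq_bigr (fun=> 1)) ?sumr_const ?card_ord // => i _.
  by rewrite dotZr su // -expr2.
exists (q^-1 *: s); split.
- by rewrite dotZl dotZr ss -q2 expr2 mulKf ?mulVf ?gt_eqF.
- move=> x xin; rewrite dotZl dot_suml big1 ?mulr0 // => i _.
  by rewrite dotZl ux0 // mulr0.
move=> x xin; rewrite dotZl normrM gtr0_norm ?invr_gt0 // mulrC ler_pdivrMr //.
have prodle y : y \in xs ->
    \prod_(i < D) expR (2 * (l * dot (u i) y) ^+ 2) <= expR (2 * l ^+ 2 * rho ^+ 2).
  move=> yin; rewrite -expR_sum ler_expR -mulr_sumr -mulrA ler_pM2l //.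
  under eq_bigr do rewrite exprMn.
  rewrite -mulr_sumr ler_pM2l ?exprn_gt0 //.
  exact: le_trans (bessel y uo) (xsr y yin).
have N0 : 0 < 2 * N%:R :> R.
  by rewrite mulr_gt0 // ltr0n (leq_trans _ sN) //; case: (xs) xin.
have key : expR (l * `|dot s x|) <= expR (ln (2 * N%:R) + 2 * l ^+ 2 * rho ^+ 2).
  rewrite expRD lnK ?posrE //.
  apply: le_trans (_ : expR (l * dot s x) + expR (- (l * dot s x)) <= _).
    case: (ger0P (dot s x)) => s0.
      by rewrite lerDl expR_ge0.
    by rewrite mulrN lerDr expR_ge0.
  apply: le_trans (_ : 2 * \sum_(y <- xs)
      1 * \prod_(i < D) expR (2 * (l * dot (u i) y) ^+ 2) <= _).
    apply: le_trans He; rewrite (big_rem _ xin) /= mul1r lerDl.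
    by apply: sumr_ge0 => y _; rewrite mul1r addr_ge0 ?expR_ge0.
  rewrite -mulrA ler_pM2l //.
  apply: le_trans (_ : \sum_(y <- xs) expR (2 * l ^+ 2 * rho ^+ 2) <= _).
    by rewrite !big_seq; apply: ler_sum => y yin; rewrite mul1r prodle.
  rewrite big_const_seq count_predT iter_addr_0 -[leLHS]mulr_natl.
  rewrite ler_wpM2r ?expR_ge0 //.
  by rewrite ler_nat.
rewrite ler_expR in key; rewrite -(ler_pM2l l0); apply: le_trans key _.
have -> : l * (h * q) = (D%:R * h ^+ 2) / (8 * rho ^+ 2) + 2 * l ^+ 2 * rho ^+ 2.
  by rewrite /l -q2; field; rewrite gt_eqF.
by rewrite lerD2r ler_pdivlMr ?mulr_gt0 ?exprn_gt0 // mulrC.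
Qed.

End FlatDirection.

(** * The adversary: a frame built against a given algorithm *)

Section ResistingFrame.
Context {R : realType} {d : nat}.
Implicit Types (v : nat -> 'rV[R]_d) (x w : 'rV[R]_d).

Definition extend_frame v j w : nat -> 'rV[R]_d :=
  fun i => if i == j then w else v i.

(** Filling slot [j] affects links [j - 1] and [j], and the linear term if [j = 0]. Link [j] stays
    in the dead zone. Link [j - 1] is unchanged if [dot w x = 0], and otherwise in the dead zone
    before and after, two halves of [delta] adding up. For [j = 0] only exact orthogonality is
    possible. *)
Lemma chain_extend_frame n a delta mu v j w x : 0 <= delta ->
  (forall i, (j <= i)%N -> v i = 0) ->
  `|dot w x| <= delta / 2 ->
  dot w x = 0 \/ (exists2 i, j = i.+1 & `|dot (v i) x| <= delta / 2) ->
  chain n a delta mu (extend_frame v j w) x = chain n a delta mu v x.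
Proof.
move=> d0 v0 wx wx0.
have vj : v j = 0 by exact: v0.
have dead z : `|z| <= delta -> soft delta z = 0 by exact: soft_dead.
have wd : `|dot w x| <= delta by apply: le_trans wx _; lra.
rewrite /chain /extend_frame; congr (_ + _ + _).
  congr (_ * _); case: eqP => // j0.
  case: wx0 => [->|[i ji _]]; last by rewrite -j0 in ji.
  by rewrite {1}j0 vj dot0l.
apply: eq_bigr => i _; congr (_ ^+ 2 / _).
have [ij|ij] := eqVneq (i : nat) j.
  rewrite gtn_eqF ?ij // v0 // vj !subr0 dot0l.
  by rewrite !dead ?normr0.
have [ij1|//] := eqVneq i.+1 j.
rewrite ij1 vj subr0 dotBl; case: wx0 => [->|[i' ji' vx]]; first by rewrite subr0.
have ii' : i' = i by apply: succn_inj; rewrite ij1.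
rewrite ii' in vx; rewrite !dead //; first by apply: le_trans vx _; lra.
by apply: le_trans (ler_normB _ _) _; lra.
Qed.

(** This is what the adversary uses of a deterministic algorithm. Both objectives are compared along
    the run on [f] only, so agreement there forces the run on [g] to coincide. *)
Definition causal (X : ('rV[R]_d -> R) -> nat -> 'rV[R]_d) :=
  forall f g k, (forall t, (t < k)%N -> f (X f t) = g (X f t)) -> X f k = X g k.

(* The frame is found one vector per stage of [s] queries.  The new vector [v j]
   is orthogonal to the queries of stage [j] and nearly orthogonal to the
   earlier ones, so that the answers given so far do not depend on it. *)
Lemma exists_resisting_frame X n s T D a delta mu c rho :
  causal X -> (forall f t, dot (X f t) (X f t) <= rho ^+ 2) ->
  0 < rho -> 0 < delta -> (0 < s)%N -> (0 < D)%N -> (n + s + D <= d)%N ->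
  8 * rho ^+ 2 * ln (2 * T.+1%:R) <= D%:R * (delta / 2) ^+ 2 ->
  exists v, [/\ orthonormal n v, v n = 0 &
    forall i t, (i < n)%N -> (t <= T)%N -> (t %/ s < i)%N ->
      `|dot (v i) (X (fun x => c * chain n a delta mu v x) t)| <= delta / 2].
Proof.
move=> Xc Xr rho0 d0 s0 D0 nsD hL.
have d20 : 0 < delta / 2 by rewrite divr_gt0.
pose F v x := c * chain n a delta mu v x.
(* The strengthening by exact orthogonality during stage [i] is what lets the induction bound the
   previous frame vector on that stage too. *)
suff [v [v0 vo vX]] : exists v, [/\ forall i, (n <= i)%N -> v i = 0,
    orthonormal n v &
    forall i t, (i < n)%N -> (t <= T)%N ->
      ((t %/ s)%N = i -> dot (v i) (X (F v) t) = 0) /\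
      ((t %/ s < i)%N -> `|dot (v i) (X (F v) t)| <= delta / 2)].
  exists v; split=> [||i t iltn tT]; [exact: vo|exact: v0|].
  by have [] := vX i t iltn tT.
suff : forall j, (j <= n)%N -> exists v, [/\ forall i, (j <= i)%N -> v i = 0,
    orthonormal j v &
    forall i t, (i < j)%N -> (t <= T)%N ->
      ((t %/ s)%N = i -> dot (v i) (X (F v) t) = 0) /\
      ((t %/ s < i)%N -> `|dot (v i) (X (F v) t)| <= delta / 2)].
  by move=> /(_ n (leqnn n)).
elim=> [_|j IH jn]; first by exists (fun=> 0); split.
have [v [v0 vo vX]] := IH (ltnW jn).
pose x := X (F v).
(* Exact orthogonality is asked to the [j] chosen vectors and the [s] points of stage [j], near
   orthogonality to all [T.+1] points of the current run, the output counting as the last one. *)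
have [|||||||w [ww wo wx]] := @exists_flat_direction R d
    (mkseq v j ++ [seq x t | t <- iota (j * s) s]) (mkseq x T.+1)
    D T.+1 rho (delta / 2) => //.
- rewrite size_cat size_map size_iota size_mkseq; apply: leq_trans nsD.
  by rewrite !leq_add2r ltnW.
- by rewrite size_mkseq.
- by move=> _ /mapP[t _ ->]; exact: Xr.
have wv i : (i < j)%N -> dot w (v i) = 0.
  move=> ij; apply: wo; rewrite mem_cat; apply/orP; left.
  by apply/mapP; exists i; rewrite ?mem_iota.
have wst t : (t %/ s)%N = j -> dot w (x t) = 0.
  move=> tj; apply: wo; rewrite mem_cat; apply/orP; right.
  apply/mapP; exists t => //; rewrite mem_iota -tj leq_trunc_div /=.
  by rewrite {1}(divn_eq t s) ltn_add2l ltn_mod.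
have wT t : (t <= T)%N -> `|dot w (x t)| <= delta / 2.
  by move=> tT; apply: wx; apply/mapP; exists t; rewrite ?mem_iota.
pose v' := extend_frame v j w.
have Fx t : (t <= T)%N -> (t %/ s <= j)%N -> F v (x t) = F v' (x t).
  move=> tT tj; rewrite /F /v' chain_extend_frame //; [exact: ltW|exact: wT|].
  move: tj; rewrite leq_eqVlt => /orP[/eqP tj|tj]; first by left; exact: wst.
  right; case: j tj v0 vo vX {IH jn wo wv wst v'} => // i tj v0 vo vX.
  exists i => //; have [vz vs] := vX i t (leqnn _) tT.
  by move: tj; rewrite ltnS leq_eqVlt => /orP[/eqP/vz ->|/vs //]; rewrite normr0 ltW.
(* Equal values up to stage [j] give equal points there by causality, so bounds proved for the old
   run pass to the new one. *)
have xx' t : (t <= T)%N -> (t %/ s <= j)%N -> X (F v') t = x t.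
  move=> tT tj; apply/esym/Xc => t' t't.
  apply: Fx; first exact: leq_trans (ltnW t't) tT.
  exact: leq_trans (leq_div2r _ (ltnW t't)) tj.
exists v'; split.
- by move=> i ji; rewrite /v' /extend_frame gtn_eqF // v0 // ltnW.
- move=> i k; rewrite /v' /extend_frame !ltnS (leq_eqVlt i) (leq_eqVlt k).
  have [->|ij] := eqVneq i j; have [->|kj] := eqVneq k j => //=.
  + by move=> _ /wv.
  + by move=> iltj _; rewrite dotC wv // (negbTE ij).
  + exact: vo.
move=> i t; rewrite ltnS => ij tT.
have -> : v' i = if i == j then w else v i by [].
have [ij'|nij] := eqVneq i j.
  rewrite ij'; split=> ti; last by rewrite (xx' t tT (ltnW ti)); exact: wT.
  by rewrite (xx' t tT) ?ti //; exact: wst.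
have iltj : (i < j)%N by rewrite ltn_neqAle nij.
have [vz vs] := vX i t iltj tT.
split=> ti; last by rewrite (xx' t tT (ltnW (leq_trans ti ij))); exact: vs.
by rewrite (xx' t tT) ?ti //; exact: vz.
Qed.

End ResistingFrame.

(** * Runs of an algorithm as causal sequences of points *)

Section Trajectory.
Context {R : realType} {d : nat}.
Variables (r : R) (T : nat) (A : algorithm d r T).
Implicit Types (f g : 'rV[R]_d -> R).

(* The point produced at time [T] (and, by convention, later) is the output. *)
Definition trajectory f (t : nat) : 'rV[R]_d :=
  if (t < T)%N then query A (transcript A f t) else output A f.

Lemma histories_rcons t (h : t.-tuple (observation R d)) o :
  histories r h -> o.1 \in l2ball r -> histories r [tuple of rcons h o].
Proof.
move=> hr or i; rewrite (tnth_nth o) /= nth_rcons size_tuple.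
case: ltngtP => [it|it|//].
  by rewrite -(tnth_nth o h (Ordinal it)); exact: hr.
by have := ltn_ord i; rewrite ltnNge it.
Qed.

Lemma transcript_histories f t : (t <= T)%N -> histories r (transcript A f t).
Proof.
elim: t => [_ [] //|t IH tT]; have h := IH (ltnW tT).
by apply: histories_rcons => //=; apply: (query_borel A tT).2; rewrite inE.
Qed.

Lemma trajectory_in_ball f t : l2norm (trajectory f t) <= r.
Proof.
suff : trajectory f t \in l2ball r by rewrite inE.
rewrite /trajectory; case: ifP => [tT|_].
  by apply: (query_borel A tT).2; rewrite inE; apply: transcript_histories; exact: ltnW.
by apply: (terminal_borel A).2; rewrite inE; exact: transcript_histories.
Qed.

Lemma trajectory_causal : causal trajectory.
Proof.
have tr f g k : (k <= T)%N ->
    (forall t, (t < k)%N -> f (trajectory f t) = g (trajectory f t)) ->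
    transcript A f k = transcript A g k.
  elim: k => [//|k IH] kT fg.
  have E : transcript A f k = transcript A g k.
    by apply: IH => [|t tk]; [exact: ltnW|apply: fg; exact: leqW].
  have := fg k (ltnSn k); rewrite /trajectory kT => fgk /=.
  by rewrite -E fgk.
move=> f g k fg; rewrite /trajectory; case: ifP => kT.
  by rewrite (tr f g) // ltnW.
rewrite /output (tr f g) // => t tT; apply: fg; apply: leq_trans tT _.
by rewrite leqNgt kT.
Qed.

End Trajectory.

(** * The suboptimality gap on the hidden chain *)

Section HardInstance.
Context {R : realType} {d : nat}.

Lemma min_value_le (r beta : R) (f : 'rV[R]_d -> R) x :
  objective_class r beta f -> min_value f <= f x.
Proof.
case=> _ _ [x0 _ [x0m _]]; apply: ge_inf; last by exists x.
by exists (f x0) => _ [y _ <-]; exact: x0m.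
Qed.

(** The witness has coordinates decreasing linearly to zero, so that every link equals [a]: it
    minimizes the chain with [delta = mu = 0]. *)
Lemma exists_chain_le n (a delta mu : R) (v : nat -> 'rV[R]_d) :
  0 <= a -> 0 <= delta -> 0 <= mu -> orthonormal n v -> v n = 0 -> (0 < n)%N ->
  exists x, chain n a delta mu v x <=
            - (n%:R * a ^+ 2) + n%:R * (a ^+ 2 / 2) + mu * (n%:R ^+ 3 * a ^+ 2).
Proof.
move=> a0 delta0 mu0 vo vn n0.
pose x := \sum_(i < n) (a * (n - i)%:R) *: v i.
have vx i : (i <= n)%N -> dot (v i) x = a * (n - i)%:R.
  rewrite leq_eqVlt => /orP[/eqP ->|iltn].
    by rewrite vn dot0l subnn mulr0.
  rewrite dot_sumr (bigD1 (Ordinal iltn)) //= dotZr vo // eqxx mulr1.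
  rewrite big1 ?addr0 // => j; rewrite -val_eqE /= eq_sym => /negbTE ij.
  by rewrite dotZr vo // ij mulr0.
exists x; rewrite /chain; apply: lerD; first apply: lerD.
- by rewrite (vx 0%N) // subn0; lra.
- apply: le_trans (_ : \sum_(i < n) a ^+ 2 / 2 <= _); last first.
    by rewrite sumr_const card_ord mulr_natl.
  apply: ler_sum => i _; rewrite dotBl vx ?vx //; last exact: ltnW.
  have -> : a * (n - i)%:R - a * (n - i.+1)%:R = a.
    by rewrite -(subnSK (ltn_ord i)) -natr1; ring.
  by rewrite ler_pM2r ?invr_gt0 //; exact: soft_sqr_le.
rewrite ler_wpM2l // /x dot_suml.
apply: le_trans (_ : \sum_(i < n) (n%:R ^+ 2 * a ^+ 2) <= _).
  apply: ler_sum => i _; rewrite dotZl vx; last exact: ltnW.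
  have : (n - i)%:R <= n%:R :> R by rewrite ler_nat leq_subr.
  have : 0 <= (n - i)%:R :> R by [].
  move: ((n - i)%:R : R) (n%:R : R) => p q p0 pq.
  have : p ^+ 2 <= q ^+ 2 by rewrite ler_pXn2r // nnegrE // (le_trans p0).
  move/(ler_wpM2r (sqr_ge0 a)); apply: le_trans.
  by rewrite le_eqVlt; apply/orP; left; apply/eqP; ring.
rewrite sumr_const card_ord -[leLHS]mulr_natl le_eqVlt.
by apply/orP; left; apply/eqP; ring.
Qed.

Lemma exists_hard_objective (r beta a : R) T (A : algorithm d r T) m s D :
  0 < r -> 0 < beta -> 0 < a -> (0 < m)%N -> (0 < D)%N ->
  (2 * m + s + D <= d)%N -> (T < m * s)%N ->
  512 * m%:R ^+ 3 * a ^+ 2 = r ^+ 2 ->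
  8 * r ^+ 2 * ln (2 * T.+1%:R) <= D%:R * (a / 32) ^+ 2 ->
  exists2 f, objective_class r beta f &
    beta / 8 * (9 / 32 * m%:R * a ^+ 2) <= f (output A f) - min_value f.
Proof.
move=> r0 beta0 a0 m0 D0 nsD Tms ar hL.
have s0 : (0 < s)%N by case: s Tms {nsD} => //; rewrite muln0.
have n0 : (0 < 2 * m)%N by rewrite muln_gt0.
have mR : 1 <= m%:R :> R by rewrite ler1n.
have mR0 : 0 < m%:R :> R by lra.
(* Two demands on [mu]: [mu * (r / 2) ^+ 2 = 2 * m * a ^+ 2] must exceed the depth
   [9/8 * m * a ^+ 2] of the chain, and the cost [m * a ^+ 2 / 8] of the witness must stay small. *)
pose mu : R := (64 * m%:R ^+ 2)^-1.
have mu0 : 0 < mu by rewrite invr_gt0 mulr_gt0 // exprn_gt0.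
have mu1 : mu <= 1.
  by rewrite invf_le1 ?mulr_gt0 ?exprn_gt0 //; have := exprn_ege1 2 mR; lra.
have d0 : 0 < a / 16 by rewrite divr_gt0.
have n2 : (2 * m)%:R = 2 * m%:R :> R by rewrite natrM.
have [||||||||v [vo vn vX]] := @exists_resisting_frame R d (trajectory A) (2 * m) s T D
  a (a / 16) mu (beta / 8) r => //.
- exact: trajectory_causal.
- by move=> f t; rewrite -l2norm_le ?trajectory_in_ball // ltW.
- by rewrite (_ : a / 16 / 2 = a / 32) //; field.
pose f x := beta / 8 * chain (2 * m) a (a / 16) mu v x.
have fobj : objective_class r beta f.
  apply: chain_objective => //; [exact: ltW|exact: ltW|by rewrite mu0|].
  rewrite expr_div_n -ar n2 /mu.
  have -> : (64 * m%:R ^+ 2)^-1 * (512 * m%:R ^+ 3 * a ^+ 2 / 2 ^+ 2) =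
      2 * m%:R * a ^+ 2 :> R by field; rewrite gt_eqF.
  by rewrite ltr_pM2l ?mulr_gt0 //; have := exprn_gt0 2 a0; lra.
exists f => //.
have out : output A f = trajectory A f T by rewrite /trajectory ltnn.
have Ts : (T %/ s < m)%N by rewrite ltn_divLR.
have ym : `|dot (v m) (output A f)| <= a / 32.
  rewrite (_ : a / 32 = a / 16 / 2); last by field.
  by rewrite out; apply: vX => //; rewrite mul2n -addnn -{1}(addn0 m) ltn_add2l.
have [x fx] := exists_chain_le (ltW a0) (ltW d0) (ltW mu0) vo vn n0.
have minx := min_value_le x fobj.
apply: le_trans (_ : f (output A f) - f x <= _); last by lra.
rewrite /f -mulrBr ler_pM2l ?divr_gt0 //.
(* Stopping the telescoping at [v m], nearly orthogonal to the output, bounds the value there below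
   by [- (19/32) * m * a ^+ 2]. The witness reaches [- (28/32) * m * a ^+ 2]. *)
have low := @chain_potential_ge R d m (2 * m) a (a / 16) v (output A f)
  (leq_pmull m (ltn0Sn 1)) (ltW d0) (ltW a0).
have quad : 0 <= mu * dot (output A f) (output A f) by rewrite mulr_ge0 ?dot_ge0 // ltW.
have ay : a * dot (v m) (output A f) <= a ^+ 2 / 32.
  rewrite expr2 -mulrA ler_pM2l //; exact: le_trans (ler_norm _) ym.
have muE : mu * ((2 * m)%:R ^+ 3 * a ^+ 2) = m%:R * a ^+ 2 / 8.
  by rewrite n2 /mu; field; rewrite gt_eqF.
have ma : a ^+ 2 <= m%:R * a ^+ 2 by rewrite ler_peMl // sqr_ge0.
rewrite muE n2 in fx; rewrite /chain in fx *.
lra.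
Qed.

End HardInstance.

(** * Choice of parameters and the complexity bound *)

Lemma query_lower_bound (R : realType) (d : nat) (r beta eps : R) T
    (A : algorithm d r T) m :
  0 < r -> 0 < beta -> 0 < eps -> (0 < m)%N ->
  m%:R ^+ 2 * eps <= (512^-1) ^+ 2 * (beta * r ^+ 2) ->
  m%:R ^+ 3 * (1 + ln d%:R) <= (512^-1) ^+ 3 * (d%:R : R) ->
  (worst_case_error beta A <= eps%:E)%E ->
  (m * (d %/ 4) <= T)%N.
Proof.
move=> r0 beta0 eps0 m0 mS mY errA; rewrite leqNgt; apply/negP => Tms.
have c512 : 0 < 512 :> R by rewrite ltr0n.
have mR : 1 <= m%:R :> R by rewrite ler1n.
have mR0 : 0 < m%:R :> R by lra.
have d1 : (0 < d)%N by case: (d) Tms => //; rewrite div0n muln0.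
have dR : 1 <= d%:R :> R by rewrite ler1n.
have dR0 : 0 < d%:R :> R by lra.
have lnd := ln_ge0 dR.
have m3 : m%:R <= m%:R ^+ 3 :> R by rewrite -{1}(expr1 m%:R) ler_weXn2l.
have md : (512 * m <= d)%N.
  rewrite -(ler_nat R) natrM; move: mY m3; nra.
(* [M], and [q1] below, are kept opaque: unfolding the numeral is costly. *)
have [M ME] : exists M : R, M = 512 * m%:R ^+ 3 by exists (512 * m%:R ^+ 3).
have M0 : 0 < M by rewrite ME; exact: mulr_gt0 c512 (exprn_gt0 3 mR0).
pose a : R := r / Num.sqrt M.
have a0 : 0 < a by rewrite divr_gt0 // sqrtr_gt0.
have ar : 512 * m%:R ^+ 3 * a ^+ 2 = r ^+ 2.
  by rewrite -ME expr_div_n sqr_sqrtr ?(ltW M0) // mulrC divfK ?gt_eqF.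
have D0 : (0 < d %/ 4)%N by move: md m0; clear; lia.
have nsD : (2 * m + d %/ 4 + d %/ 4 <= d)%N by move: md m0; clear; lia.
have DR : (d%:R : R) <= 8 * (d %/ 4)%:R.
  by rewrite -natrM ler_nat; move: md m0; clear; lia.
(* The assumption [T < m * (d %/ 4)], made for contradiction, bounds the number of points by a power
   of [d]. *)
have lnT : ln (2 * T.+1%:R) <= 2 * ln d%:R :> R.
  have -> : 2 * ln d%:R = ln (d%:R ^+ 2) :> R by rewrite lnXn // mulr_natl.
  rewrite -natrM -natrX ler_ln ?posrE ?ltr0n ?expn_gt0 ?d1 //.
  rewrite ler_nat; apply: leq_trans (_ : 2 * (m * (d %/ 4)) <= _)%N.
    by rewrite leq_mul2l.
  by move: md; clear; nia.
have [|f fobj fgap] :=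
  @exists_hard_objective R d r beta a T A m _ _ r0 beta0 a0 m0 D0 nsD Tms ar.
  rewrite -ar; have a2 := exprn_gt0 2 a0.
  have PL : m%:R ^+ 3 * ln (2 * T.+1%:R) <= 2 * ((512^-1) ^+ 3 * d%:R) :> R.
    have P0 : 0 < m%:R ^+ 3 :> R by rewrite exprn_gt0.
    have := ler_wpM2l (ltW P0) lnT; move: mY P0.
    move: (m%:R ^+ 3 : R) ((512^-1) ^+ 3 * d%:R : R) => P Z.
    by move: (ln d%:R) (P * ln _) => ? ?; lra.
  have -> : 8 * (512 * m%:R ^+ 3 * a ^+ 2) * ln (2 * T.+1%:R) =
            a ^+ 2 * (4096 * (m%:R ^+ 3 * ln (2 * T.+1%:R))) :> R by ring.
  have -> : (d %/ 4)%:R * (a / 32) ^+ 2 = a ^+ 2 * ((d %/ 4)%:R / 1024) by field.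
  rewrite ler_pM2l //; move: PL DR; lra.
have : ((f (output A f) - min_value f)%:E <= eps%:E)%E.
  apply: le_trans errA; apply: ereal_sup_ubound; by exists f.
rewrite lee_fin leNgt => /negP; apply; apply: lt_le_trans fgap.
have m2 : 0 < m%:R ^+ 2 :> R by rewrite exprn_gt0.
(* After multiplication by [m ^+ 2], [eps] is at most [1/512] and the gap is [9/256] of
   [beta * m ^+ 3 * a ^+ 2]. *)
rewrite -(ltr_pM2l m2); apply: le_lt_trans mS _; rewrite -ar.
have Q0 : 0 < beta * (m%:R ^+ 3 * a ^+ 2) by rewrite mulr_gt0 // mulr_gt0 // exprn_gt0.
have -> : (512^-1) ^+ 2 * (beta * (512 * m%:R ^+ 3 * a ^+ 2)) =
          beta * (m%:R ^+ 3 * a ^+ 2) / 512 by field.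
have -> : m%:R ^+ 2 * (beta / 8 * (9 / 32 * m%:R * a ^+ 2)) =
          beta * (m%:R ^+ 3 * a ^+ 2) * (9 / 256) by field.
by rewrite ltr_pM2l //; lra.
Qed.

Theorem theorem3p5 (R : realType) :
  exists (c c_eps : R) (d0 : nat),
    [/\ 0 < c, 0 < c_eps, (0 < d0)%N &
      forall (d : nat) (r beta eps : R), (d0 <= d)%N ->
        0 < r -> 0 < beta -> 0 < eps -> eps <= c_eps * (beta * r ^+ 2) ->
        ((c * d%:R * Num.min (Num.sqrt (beta * r ^+ 2 / eps))
                             ((d%:R / ln (expR 1 * d%:R)) `^ 3^-1))%:E
         <= Nval_det_ad d r beta eps)%E].
Proof.
have c512 : 0 < 512 :> R by rewrite ltr0n.
pose K : R := 512^-1; have K0 : 0 < K by rewrite invr_gt0.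
have [q1 q1E] : exists q : R, q = 3 * 512 ^+ 3 by exists (3 * 512 ^+ 3).
(* The 16 is 2 for rounding [K * X] down to [m], times 8 for [d %/ 4] against [d]. The bounds on
   [eps] and [d] ensure [K * S >= 1] and [K * Y >= 1], hence [m >= 1]. *)
exists (K / 16), (K ^+ 2), (Num.truncn (q1 ^+ 2)).+1; split => //.
- by rewrite divr_gt0.
- by rewrite exprn_gt0.
move=> d r beta eps dd r0 beta0 eps0 epsle.
have q1K : q1 * K ^+ 3 = 3 by rewrite q1E /K; field.
have q11 : 3 <= q1.
  by rewrite q1E; have : 1 <= 512 ^+ 3 :> R; [apply: exprn_ege1; lra|lra].
have dbig : q1 ^+ 2 < d%:R.
  apply: lt_le_trans (_ : (Num.truncn (q1 ^+ 2)).+1%:R <= _); last by rewrite ler_nat.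
  by have /andP[] := @truncn_itv R (q1 ^+ 2) (sqr_ge0 _).
have KE : 512^-1 = K by [].
clearbody K; clear q1E c512.
have dR0 : 0 < d%:R :> R by apply: le_lt_trans dbig; rewrite sqr_ge0.
have dN0 : (0 < d)%N by rewrite -(ltr0n R).
have dR1 : 1 <= d%:R :> R by rewrite ler1n.
have lnE : ln (expR 1 * d%:R) = 1 + ln d%:R :> R.
  by rewrite lnM ?posrE ?expR_gt0 // expRK.
have lnd := ln_ge0 dR1.
rewrite lnE; set l := 1 + ln d%:R; have l0 : 0 < l by rewrite /l; lra.
set S := Num.sqrt _; set Y := _ `^ _; set X := Num.min S Y.
have br0 : 0 < beta * r ^+ 2 by rewrite mulr_gt0 ?exprn_gt0.
have S0 : 0 <= S by rewrite sqrtr_ge0.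
have Y0 : 0 <= Y by rewrite powR_ge0.
have S2 : S ^+ 2 * eps = beta * r ^+ 2.
  by rewrite sqr_sqrtr ?divfK ?gt_eqF // divr_ge0 // ltW.
have Y3 : Y ^+ 3 * l = d%:R.
  rewrite -powR_mulrn // -powRrM mulVf // powRr1 ?divfK ?gt_eqF //.
  by rewrite divr_ge0 // ltW.
have KS : 1 <= K * S.
  have KS0 : 0 <= K * S by rewrite mulr_ge0 // ltW.
  rewrite -(ler_pXn2r (ltn0Sn 1)) ?nnegrE // expr1n exprMn -(ler_pM2r eps0).
  by rewrite mul1r -mulrA S2.
have KY : 1 <= K * Y.
  have KY0 : 0 <= K * Y by rewrite mulr_ge0 // ltW.
  rewrite -(ler_pXn2r (ltn0Sn 2)) ?nnegrE // expr1n exprMn -(ler_pM2r l0).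
  rewrite mul1r -mulrA Y3.
  pose q := Num.sqrt (d%:R : R).
  have q2 : q ^+ 2 = d%:R by rewrite sqr_sqrtr // ltW.
  have qq1 : q1 <= q.
    have q0 : 0 <= q := sqrtr_ge0 _.
    by rewrite leNgt; apply/negP => qq; move: dbig; rewrite -q2; nra.
  have q0 : 0 < q by lra.
  (* With [d = q ^+ 2], [l = 1 + 2 * ln q] grows at most linearly in [q], and [q1 * K ^+ 3 = 3] was
     arranged to absorb the 3. *)
  have lq : l <= 3 * q.
    by have := ln_sublinear q0; rewrite /l -q2 lnXn // -mulr_natl; lra.
  apply: le_trans lq _; rewrite -q2 expr2 mulrA ler_pM2r //.
  by rewrite -q1K mulrC ler_pM2l ?exprn_gt0.
have KX : 1 <= K * X by rewrite /X minEle; case: ifP.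
have X0 : 0 <= X by rewrite le_min S0 Y0.
pose m := Num.truncn (K * X).
have /andP[mX Xm] : m%:R <= K * X < m.+1%:R by apply: truncn_itv; lra.
have m0 : (0 < m)%N by rewrite lt0n; apply: contraTneq Xm => ->; rewrite -leNgt.
have mR : 1 <= m%:R :> R by rewrite ler1n.
have mS : m%:R <= K * S by apply: le_trans mX _; rewrite ler_pM2l // ge_min lexx.
have mY : m%:R <= K * Y by apply: le_trans mX _; rewrite ler_pM2l // ge_min lexx orbT.
apply: le_ereal_inf_tmp => _ [T [A errA] <-]; rewrite lee_fin.
have mT : (m * (d %/ 4) <= T)%N.
  apply: query_lower_bound errA => //.
    rewrite KE -S2 mulrA -exprMn ler_pM2r //.
    by rewrite ler_pXn2r // nnegrE; lra.
  rewrite KE -[X in _ <= _ * X]Y3 mulrA -exprMn ler_pM2r //.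
  by rewrite ler_pXn2r // nnegrE; lra.
apply: le_trans (_ : (m * (d %/ 4))%:R <= _); last by rewrite ler_nat.
have dq : (4 <= d)%N.
  by rewrite -(ler_nat R); apply: le_trans (ltW dbig); nra.
have DR : (d%:R : R) <= 8 * (d %/ 4)%:R.
  by rewrite -natrM ler_nat; move: dq; clear; lia.
rewrite natrM; rewrite -natr1 in Xm.
move: ((d %/ 4)%:R : R) DR => q DR.
have {}Xm : K * X <= 2 * m%:R by lra.
have KXq : K * X * d%:R <= 2 * m%:R * (8 * q) by rewrite ler_pM // mulr_ge0 // ltW.
lra.
Qed.
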